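(* There is no odd positive integer $n<10^5$ that is a strong alpha number of order $(1,1)$.
   Context: For a positive integer $n$, $\sigma(n)=\sum_{d\mid n} d$ and $\omega(n)$ is the number of distinct prime divisors of $n$. A positive integer $n$ is a strong alpha number of order $(1,1)$ if there exist coprime positive integers $\alpha_1,\alpha_2$ with $\sigma(n)=\frac{\alpha_1}{\alpha_2}n$ and $2\le \max(\alpha_1,\alpha_2)\le \omega(n)$. *)

(* Defs.v *)
From mathcomp Require Import all_boot all_order all_algebra.

Set Implicit Arguments.
Unset Strict Implicit.
Unset Printing Implicit Defensive.

Definition sigma (n : nat) : nat := \sum_(d <- divisors n) d.

Definition omega (n : nat) : nat := size (primes n).

(* The positivity of n is part of the notion: divisors 0 and primes 0 are
   both the empty list. *)
Definition strong_alpha11 (n : nat) : Prop :=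
  0 < n /\
  exists a1 a2 : nat,
    [/\ 0 < a1, 0 < a2, coprime a1 a2,
        ((sigma n)%:R = a1%:R / a2%:R * n%:R :> rat)%R
      & 2 <= maxn a1 a2 <= omega n].

(* Main.v *)
(* Write a2 sigma(n) = a1 n with a1, a2 coprime. Then a2 divides n, so a2 is odd.
   Since the prime factors of n are distinct odd numbers, n < 10^5 forces
   omega(n) <= 5, as 3.5.7.9.11.13 > 10^5, and
   sigma(n)/n <= 3/2.5/4.7/6.9/8.11/10 < 3. The only ratios left are 4/3, 5/3
   and 2.
   - 4/3: 3 divides n, and n, n/3 and 1 already sum to more than 4n/3.
   - 5/3: sigma(n) is odd, so every prime factor of n occurs at least twice
     (otherwise p + 1 divides sigma(n)), and n >= (3.5.7.9.11)^2.
   - 2: if 3 does not divide n then sigma(n)/n <= 5/4.7/6.9/8.11/10.13/12 < 2.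
     Otherwise p^a sigma(p^a) divides 2n whenever p^a is the exact power of p in
     n, so the exponent of 3 forces a factor 13 or 11, whose exponent forces 7,
     61 or 19, until either 4 divides 2n or n exceeds the bound. *)
Require Import Defs.
From mathcomp Require Import all_boot all_order all_algebra zify.
Import GRing.Theory Num.Theory.

Set Implicit Arguments.
Unset Strict Implicit.
Unset Printing Implicit Defensive.

(** The products [d * e] with [d %| m] and [e %| n] list the divisors of [m * n] without repetition:
    [d] is recovered as the gcd of [d * e] and [m]. *)
Lemma sigmaM m n : coprime m n -> 0 < m -> 0 < n ->
  sigma (m * n) = sigma m * sigma n.
Proof.
move=> co_mn m0 n0; rewrite /sigma.
have gcdK d e : d %| m -> e %| n -> gcdn (d * e) m = d.
  move=> dm en; have co : coprime m e by rewrite (coprime_dvdr en).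
  by rewrite gcdnC Gauss_gcdl // gcdnC; apply/gcdn_idPl.
rewrite (perm_big [seq d * e | d <- divisors m, e <- divisors n]) /=.
  rewrite big_allpairs_dep big_distrl /=.
  by apply: eq_bigr => d _; rewrite big_distrr.
apply: uniq_perm; first exact: divisors_uniq.
  apply: allpairs_uniq; rewrite ?divisors_uniq // => -[d e] [d' e'].
  case/allpairsP=> -[u v] /= [um vn [-> ->]].
  case/allpairsP=> -[u' v'] /= [u'm v'n [-> ->]].
  move: um vn u'm v'n; rewrite -!dvdn_divisors // => um vn u'm v'n E.
  have eu : u = u' by rewrite -(gcdK u v) // E gcdK.
  move: E; rewrite -eu => /eqP; rewrite eqn_pmul2l ?(dvdn_gt0 m0) //.
  by move/eqP->.
move=> d; rewrite -dvdn_divisors ?muln_gt0 ?m0 //; apply/idP/allpairsP.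
  move=> dmn; exists (gcdn d m, gcdn d n); rewrite /= -!dvdn_divisors // !dvdn_gcdr.
  split=> //; apply/eqP; rewrite eqn_dvd; apply/andP; split.
    by rewrite muln_gcdl dvdn_gcd dvdn_mulr //= muln_gcdr dvdn_gcd dvdn_mull.
  rewrite Gauss_dvd.
    by rewrite !dvdn_gcdl.
  by rewrite (coprime_dvdl (dvdn_gcdr d m)) // (coprime_dvdr (dvdn_gcdr d n)).
by case=> -[u v] /= []; rewrite -!dvdn_divisors // => um vn ->; apply: dvdn_mul.
Qed.

Lemma sigma_pfactor p a : prime p -> sigma (p ^ a) = \sum_(i < a.+1) p ^ i.
Proof.
move=> pp; have p1 := prime_gt1 pp; rewrite /sigma.
rewrite (perm_big [seq p ^ i | i <- index_iota 0 a.+1]).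
  by rewrite big_map big_mkord.
apply: uniq_perm; first exact: divisors_uniq.
  by rewrite map_inj_uniq ?iota_uniq //; apply: expnI.
move=> d; rewrite -dvdn_divisors ?expn_gt0 ?prime_gt0 //.
apply/(dvdn_pfactor _ _ pp)/mapP => -[i Hi ->]; exists i => //; move: Hi.
  by rewrite mem_index_iota.
by rewrite mem_index_iota.
Qed.

Lemma sigma_pfactor_le p a : prime p -> p.-1 * sigma (p ^ a) <= p * p ^ a.
Proof. by move=> pp; rewrite sigma_pfactor // -predn_exp expnS leq_pred. Qed.

(** By its geometric sum, [sigma (p ^ a)] is 1 modulo [p], hence coprime to [p ^ a]; it divides
    [sigma n] by multiplicativity. *)
Lemma sigma_pfactorM_dvd p n a1 a2 : prime p -> 0 < n -> a2 * sigma n = a1 * n ->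
  p ^ logn p n * sigma (p ^ logn p n) %| a1 * n.
Proof.
move=> pp n0; have [m co En] := pfactor_coprime pp n0.
set a := logn p n in En *.
have m0 : 0 < m by case: (m) En => //; lia.
have pa0 : 0 < p ^ a by rewrite expn_gt0 prime_gt0.
have co' : coprime m (p ^ a) by rewrite coprimeXr // coprime_sym.
rewrite {1}En sigmaM // => E.
rewrite Gauss_dvd; last first.
  rewrite coprimeXl // sigma_pfactor // big_ord_recl expn0.
  rewrite (eq_bigr (fun i : 'I_a => p * p ^ i)) => [|i _]; last by rewrite -expnS.
  by rewrite -big_distrr /= addnC mulnC /coprime gcdnMDl gcdn1.
by rewrite -{2}E !dvdn_mull // En dvdn_mull.
Qed.

Lemma sigma_logn_dvd p n c a1 a2 : prime p -> 0 < n -> a2 * sigma n = a1 * n ->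
  logn p n = c -> p ^ c * \sum_(i < c.+1) p ^ i %| a1 * n.
Proof.
by move=> pp n0 E <-; rewrite -sigma_pfactor //; apply: sigma_pfactorM_dvd E.
Qed.

Lemma omega_pfactorM p m a : prime p -> 0 < a -> 0 < m -> coprime p m ->
  omega (p ^ a * m) = (omega m).+1.
Proof.
move=> pp a0 m0 co; rewrite /omega.
have p1 : perm_eq (primes (p ^ a * m)) (p :: primes m).
  apply: uniq_perm; rewrite ?primes_uniq //= ?primes_uniq ?andbT.
    by rewrite mem_primes pp m0 -prime_coprime ?co.
  move=> q; rewrite primesM // ?expn_gt0 ?prime_gt0 // primesX // primes_prime //.
  by rewrite !inE.
by rewrite (perm_size p1).
Qed.

(** Induction step for the two bounds below: split off the least prime [p]. The other primes are odd
    and exceed [p], which is at least 2j + 1, so [j] can grow by one. *)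
Lemma least_pfactor (j n : nat) : 1 < n -> odd n ->
    (forall q, prime q -> q %| n -> 2 * j < q) ->
  exists p m, let a := logn p n in
   [/\ [/\ prime p, 2 * j < p, 0 < a, 0 < m & odd m],
       [/\ coprime p m, n = p ^ a * m & omega n = (omega m).+1]
     & forall q, prime q -> q %| m ->
         [/\ q %| n, logn q n = logn q m & 2 * j.+1 < q]].
Proof.
move=> n1 on hj; have pp := pdiv_prime n1; set p := pdiv n in pp *.
have n0 : 0 < n by apply: ltnW.
have pn : p %| n := pdiv_dvd n.
have [m co En] := pfactor_coprime pp n0.
exists p, m => a; rewrite mulnC in En.
have m0 : 0 < m by case: (m) En => //; lia.
have a0 : 0 < a by rewrite /a logn_gt0 mem_primes pp n0.
have om : odd m by move: on; rewrite En oddM => /andP[].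
have op : odd p by apply: dvdn_odd pn on.
split; first by split=> //; exact: hj.
  by split=> //; rewrite {1}En omega_pfactorM.
move=> q pq qm; have qn : q %| n by rewrite En dvdn_mull.
have pqle : p <= q by apply: pdiv_min_dvd (prime_gt1 pq) qn.
have pnq : p != q.
  apply: contraTneq co => ->.
  by rewrite prime_coprime // negbK.
have oq : odd q by apply: dvdn_odd qn on.
split=> //; last by have := hj p pp pn; lia.
rewrite {1}En lognM // ?expn_gt0 ?prime_gt0 // lognX (logn_prime q pp).
by rewrite [q == p]eq_sym (negPf pnq) muln0.
Qed.

(* Its factors 2j+1, 2j+3, ... bound from below, one by one, k distinct odd
   primes exceeding 2j. *)
Definition oddprod j k := \prod_(i < k) (2 * (j + i) + 1).

Lemma oddprodS j k : oddprod j k.+1 = (2 * j + 1) * oddprod j.+1 k.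
Proof.
rewrite /oddprod big_ord_recl addn0; congr (_ * _).
by apply: eq_bigr => i _; rewrite addSnnS.
Qed.

(** Used with [e = 1] to bound [omega n], and with [e = 2] when every prime factor is repeated. *)
Lemma oddprod_leq e k j n : 0 < n -> odd n ->
    (forall q, prime q -> q %| n -> 2 * j < q) ->
    (forall q, prime q -> q %| n -> e <= logn q n) ->
  k <= omega n -> oddprod j k ^ e <= n.
Proof.
elim: k j n => [|k IH] j n n0 on hj he; first by rewrite /oddprod big_ord0 exp1n.
have [n1|] := leqP n 1; first by have -> : n = 1 by lia.
move=> n1; have [p [m]] := least_pfactor n1 on hj.
move=> /= [[pp jp a0 m0 om] [co En ->] hq]; rewrite ltnS => km.
rewrite oddprodS expnMn En leq_mul //.
  have le : e <= logn p n by apply: he => //; rewrite En dvdn_mulr // dvdn_exp.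
  apply: leq_trans (leq_pexp2l (prime_gt0 pp) le).
  by case: (e) => [|e0]; rewrite ?expn0 // leq_exp2r; lia.
apply: IH => // q pq qm; have [qn ql] := hq q pq qm; first by [].
by rewrite -ql => _; apply: he.
Qed.

(** A prime power of [p] contributes at most p/(p-1) to sigma(n)/n, which for j > 0 is at most
    (2j+1)/(2j) when p > 2j; denominators are cleared. If [omega n < k], the surplus factors only
    weaken the bound. *)
Lemma sigma_leq k j n : 0 < n -> odd n ->
    (forall q, prime q -> q %| n -> 2 * j < q) -> omega n <= k ->
  sigma n * \prod_(i < k) (2 * (j + i)) <= n * oddprod j k.
Proof.
elim: k j n => [|k IH] j n n0 on hj.
  have [n1 _|n1] := leqP n 1.
    have -> : n = 1 by lia.
    by rewrite /sigma /oddprod !big_ord0 big_seq1.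
  by have [p [m /= [_ [_ _ ->]]]] := least_pfactor n1 on hj.
have [n1 _|n1] := leqP n 1.
  have -> : n = 1 by lia.
  rewrite /sigma big_seq1 !mul1n /oddprod.
  by apply: leq_prod => i _; rewrite leq_addr.
have [p [m]] := least_pfactor n1 on hj.
move=> /= [[pp jp a0 m0 om] [co En ->] hq]; rewrite ltnS => km.
have {IH}H : sigma m * \prod_(i < k) (2 * (j.+1 + i)) <= m * oddprod j.+1 k.
  by apply: IH => // q pq qm; have [] := hq q pq qm.
have S := sigma_pfactor_le (logn p n) pp.
rewrite big_ord_recl oddprodS addn0 {1 2}En.
rewrite sigmaM ?coprimeXl ?expn_gt0 ?(prime_gt0 pp) //.
under eq_bigr => i _ do rewrite -addSnnS.
rewrite mulnACA [leqRHS]mulnACA leq_mul // {H}.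
have p0 : 0 < p.-1 by have := prime_gt1 pp; lia.
rewrite -(leq_pmul2l p0).
rewrite mulnA; apply: leq_trans (leq_mul S (leqnn _)) _.
rewrite mulnAC [leqRHS]mulnA [leqRHS]mulnAC leq_mul //.
nia.
Qed.

Lemma sigma_gt n d : 1 < d -> d < n -> d %| n -> n + d < sigma n.
Proof.
move=> d1 dn dvd; have n0 : 0 < n by lia.
have nd : d != n by lia.
rewrite /sigma (bigD1_seq n) ?divisors_id ?divisors_uniq //= ltn_add2l.
rewrite (big_rem d) /= -?dvdn_divisors // nd (big_rem 1) /=; last first.
  by rewrite mem_rem_uniq ?divisors_uniq // inE divisor1 /= andbT; lia.
have -> : 1 != n by lia.
by rewrite addnA addn1 leq_addr.
Qed.

Lemma sigma_geq n : 0 < n -> n <= sigma n.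
Proof.
by move=> n0; rewrite /sigma (bigD1_seq n) ?divisors_id ?divisors_uniq ?leq_addr.
Qed.

Lemma odd_perfect_ge n : odd n -> 3 %| n -> sigma n = 2 * n -> 10 ^ 5 <= n.
Proof.
move=> on n3 perf; have n0 : 0 < n by lia.
rewrite leqNgt; apply/negP => ltn.
have E : 1 * sigma n = 2 * n by rewrite mul1n.
have key p c pp := @sigma_logn_dvd p n c _ _ pp n0 E.
have pow p c pp : (p ^ c %| n) = (c <= logn p n) := @pfactor_dvdn p c n pp n0.
have a0 : 1 <= logn 3 n by rewrite -pow.
(* As [sigma (3 ^ a)] is at least [3 ^ a], an exponent of 6 or more would give 3^12 <= 2n < 2 *
   10^5. *)
have a6 : logn 3 n < 6.
  rewrite ltnNge; apply/negP => a6.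
  have := dvdn_leq (_ : 0 < 2 * n) (sigma_pfactorM_dvd (isT : prime 3) n0 E).
  rewrite muln_gt0 n0 => /(_ isT) H2.
  have := @sigma_geq (3 ^ logn 3 n); rewrite expn_gt0 => /(_ isT) H1.
  have h : 3 ^ 6 <= 3 ^ logn 3 n by rewrite leq_exp2l.
  have := leq_trans (leq_mul h (leq_trans h H1)) H2; lia.
(* Exponents 1, 3 and 5 die at once: sigma(3^a) is 4, 40 or 364, so 4 would divide 2n. *)
case a: (logn 3 n) a0 a6 => [|[|[|[|[|[|//]]]]]] // _ _;
  have := key 3 _ isT a; rewrite !big_ord_recr big_ord0 /= => K; try lia.
(* Exponent 2: sigma(9) = 13. Then sigma(13) = 14 forces 7 and sigma(13^2) = 3 * 61 forces 61, while
   sigma(13^3) = 2380 is a multiple of 4. *)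
- have b0 : 1 <= logn 13 n by rewrite -pow //; lia.
  have b4 : logn 13 n < 4 by rewrite ltnNge -pow //; apply/negP; lia.
  case b: (logn 13 n) b0 b4 => [|[|[|[|//]]]] // _ _;
    have := key 13 _ isT b; rewrite !big_ord_recr big_ord0 /= => L; try lia.
  + have c0 : 1 <= logn 7 n by rewrite -pow //; lia.
    have c4 : logn 7 n < 4 by rewrite ltnNge -pow //; apply/negP; lia.
    (* sigma(7) = 8 and sigma(7^3) = 400 are multiples of 4; sigma(7^2) = 3 * 19, and 9 * 13 * 49 *
       19 > 10^5. *)
    case c: (logn 7 n) c0 c4 => [|[|[|[|//]]]] // _ _;
      have := key 7 _ isT c; rewrite !big_ord_recr big_ord0 /=; lia.
  + have c0 : 1 <= logn 61 n by rewrite -pow //; lia.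
    have c2 : logn 61 n < 2 by rewrite ltnNge -pow //; apply/negP; lia.
    (* sigma(61) = 2 * 31, and 9 * 13 * 61 * 31 > 10^5. *)
    case c: (logn 61 n) c0 c2 => [|[|//]] // _ _.
    have := key 61 _ isT c; rewrite !big_ord_recr big_ord0 /=; lia.
(* Exponent 4: sigma(81) = 11^2, and then sigma(11^2) = 7 * 19 makes n too large. *)
- have b2 : 2 <= logn 11 n by rewrite -pow //; lia.
  have b3 : logn 11 n < 3 by rewrite ltnNge -pow //; apply/negP; lia.
  have b : logn 11 n = 2 by lia.
  have := key 11 _ isT b; rewrite !big_ord_recr big_ord0 /=; lia.
Qed.

Theorem theorem4p1 :
  ~ (exists n : nat, [/\ 0 < n, odd n, n < 10 ^ 5 & strong_alpha11 n]).
Proof.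
case=> n [n0 on ltn [_ [a1 [a2 [a10 a20 co Eq /andP[le2 leo]]]]]].
have E : a2 * sigma n = a1 * n.
  apply/eqP; rewrite -(eqr_nat rat) !natrM Eq mulrC mulrAC divfK //.
  by rewrite pnatr_eq0 -lt0n.
have a2n : a2 %| n by rewrite -(@Gauss_dvdr _ a1) 1?coprime_sym // -E dvdn_mulr.
have oa2 : odd a2 by apply: dvdn_odd a2n on.
have gt2 q : prime q -> q %| n -> 2 * 1 < q.
  move=> pq qn; have := dvdn_odd qn on; have := prime_gt1 pq; lia.
have pos q : prime q -> q %| n -> 1 <= logn q n.
  by move=> pq qn; rewrite logn_gt0 mem_primes pq n0.
have om5 : omega n <= 5.
  rewrite leqNgt; apply/negP => /(oddprod_leq n0 on gt2 pos).
  by rewrite /oddprod !big_ord_recr big_ord0 /=; lia.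
have ub : sigma n < 3 * n.
  have := sigma_leq n0 on gt2 om5.
  rewrite /oddprod !big_ord_recr !big_ord0 /=; lia.
have sn := sigma_geq n0.
have a12 : a2 <= a1 by rewrite -(leq_pmul2r n0) -E leq_mul2l sn orbT.
have a12n : a1 != a2.
  by apply: contraTneq co => ea; move: le2; rewrite ea maxnn /coprime gcdnn; lia.
have a15 : a1 <= 5 by lia.
(* [a2] is odd and below [a1 <= 5], so it is 1 or 3; the last alternative contradicts [ub]. *)
have [[ea1 ea2]|[[ea1 ea2]|[[ea1 ea2]|[a13 ea2]]]] :
    a1 = 2 /\ a2 = 1 \/ (a1 = 4 /\ a2 = 3 \/ (a1 = 5 /\ a2 = 3 \/ 3 <= a1 /\ a2 = 1)).
  by lia.
- rewrite ea1 ea2 mul1n in E.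
  have [n3|n3] := boolP (3 %| n).
    by have := odd_perfect_ge on n3 E; rewrite leqNgt ltn.
  have gt4 q : prime q -> q %| n -> 2 * 2 < q.
    move=> pq qn; have := gt2 q pq qn; have := dvdn_odd qn on.
    have : q != 3 by apply: contraNneq n3 => <-.
    lia.
  have := sigma_leq n0 on gt4 om5.
  by rewrite /oddprod !big_ord_recr !big_ord0 /=; lia.
(* sigma(3)/3 is indeed 4/3; only [omega 3 = 1 < 4] excludes n = 3. Otherwise n/3 > 1 is a third
   divisor beside n and 1. *)
- rewrite ea1 ea2 in E a2n; have n3 : n != 3.
    by apply: contraTneq leo => ->; rewrite ea1 ea2.
  have := @sigma_gt n (n %/ 3); rewrite dvdn_div; lia.
- rewrite ea1 ea2 in E a2n leo.
  have sq q : prime q -> q %| n -> 2 <= logn q n.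
    move=> pq qn; rewrite ltn_neqAle pos // andbT eq_sym; apply/eqP => q1.
    have := sigma_logn_dvd pq n0 E q1; rewrite !big_ord_recr big_ord0 /= => H.
    have oq := dvdn_odd qn on.
    have H2 : 2 %| 5 * n by apply: dvdn_trans H; rewrite dvdn_mull //; lia.
    by lia.
  have o5 : 5 <= omega n by move: leo; lia.
  have := oddprod_leq n0 on gt2 sq o5.
  by rewrite /oddprod !big_ord_recr big_ord0 /=; lia.
- by rewrite ea2 mul1n in E; nia.
Qed.
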